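(* Let $A=\sigma(R)\langle x_1,\dots,x_n\rangle$ be a bijective skew PBW extension of a left Ore domain $R$. Then $A$ is a left Ore domain; hence $A$ has a left total division ring of fractions, and $$Q_l(A)\cong Q_l\big(\sigma(Q_l(R))\langle x'_1,\dots,x'_n\rangle\big).$$ If $R$ is a right Ore domain, then $A$ is a right Ore domain; hence $A$ has a right total division ring of fractions, and $$Q_d(A)\cong Q_d\big(\sigma(Q_d(R))\langle x''_1,\dots,x''_n\rangle\big).$$
   Context: Rings are associative with identity. Skew PBW extension. Let $R$ and $A$ be rings. $A$ is a skew PBW extension of $R$, written $A=\sigma(R)\langle x_1,\dots,x_n\rangle$, if the following hold. (i) $R\subseteq A$. (ii) There are $x_1,\dots,x_n\in A$ such that $A$ is a free left $R$-module with basis $\{x_1^{\alpha_1}\cdots x_n^{\alpha_n}:\alpha\in\mathbb N^n\}$. (iii) For each $i$ and $r\in R\setminus\{0\}$ there is $c_{i,r}\in R\setminus\{0\}$ with $x_ir-c_{i,r}x_i\in R$. (iv) For all $i,j$ there is $c_{i,j}\in R\setminus\{0\}$ with $x_jx_i-c_{i,j}x_ix_j\in R+Rx_1+\dots+Rx_n$. There are injective endomorphisms $\sigma_i$ of $R$ and $\sigma_i$-derivations $\delta_i$ with $x_ir=\sigma_i(r)x_i+\delta_i(r)$. $A$ is bijective if every $\sigma_i$ is bijective and every $c_{i,j}$ ($i<j$) is invertible. Notation for the localized extensions. Let $S=R\setminus\{0\}$. - $\sigma(Q_l(R))\langle x'_1,\dots,x'_n\rangle$ denotes the left localization $S^{-1}A$.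 It is a bijective skew PBW extension of $Q_l(R)=S^{-1}R$ in the elements $x'_i=\frac{x_i}{1}$, with constants $\frac{c_{i,j}}{1}$ and $\frac{\sigma_i(r)}{\sigma_i(s)}$. - $\sigma(Q_d(R))\langle x''_1,\dots,x''_n\rangle$ denotes the right localization $AS^{-1}$, a bijective skew PBW extension of $Q_d(R)$ in the elements $x''_i=\frac{x_i}{1}$. Left/right Ore domain: domain satisfying the left/right Ore condition for all nonzero elements. $Q_l$ and $Q_d$ denote left and right total division rings of fractions. *)

(* Defs.v *)
From HB Require Import structures.
From mathcomp Require Import all_boot all_order all_algebra.
Set Implicit Arguments. Unset Strict Implicit. Unset Printing Implicit Defensive.
Import GRing.Theory.
Local Open Scope ring_scope.

(* two-sided inverse, stated without requiring a unitRingType structure *)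
Definition is_inv (T : nzRingType) (u v : T) : Prop := u * v = 1 /\ v * u = 1.

Definition invertible (T : nzRingType) (u : T) : Prop := exists v, is_inv u v.

Definition is_domain (T : nzRingType) : Prop :=
  forall a b : T, a * b = 0 -> a = 0 \/ b = 0.

Definition left_Ore_domain (T : nzRingType) : Prop :=
  is_domain T /\
  forall a s : T, s != 0 -> exists a' s' : T, s' != 0 /\ s' * a = a' * s.

Definition right_Ore_domain (T : nzRingType) : Prop :=
  is_domain T /\
  forall a s : T, s != 0 -> exists a' s' : T, s' != 0 /\ a * s' = s * a'.

Definition division_ring (T : nzRingType) : Prop :=
  forall q : T, q != 0 -> invertible q.

Definition left_total_fractions (D Q : nzRingType) (phi : {rmorphism D -> Q}) : Prop :=
  [/\ division_ring Q, injective phi &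
      forall q : Q, exists (s a : D) (y : Q), [/\ s != 0, is_inv (phi s) y & q = y * phi a]].

Definition right_total_fractions (D Q : nzRingType) (phi : {rmorphism D -> Q}) : Prop :=
  [/\ division_ring Q, injective phi &
      forall q : Q, exists (s a : D) (y : Q), [/\ s != 0, is_inv (phi s) y & q = phi a * y]].

Definition left_localization (R A B : nzRingType) (iota : {rmorphism R -> A})
    (psi : {rmorphism A -> B}) : Prop :=
  [/\ forall r : R, r != 0 -> invertible (psi (iota r)),
      forall b : B, exists (r : R) (a : A) (y : B),
        [/\ r != 0, is_inv (psi (iota r)) y & b = y * psi a] &
      forall a : A, psi a = 0 <-> exists r : R, r != 0 /\ iota r * a = 0].

Definition right_localization (R A B : nzRingType) (iota : {rmorphism R -> A})
    (psi : {rmorphism A -> B}) : Prop :=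
  [/\ forall r : R, r != 0 -> invertible (psi (iota r)),
      forall b : B, exists (r : R) (a : A) (y : B),
        [/\ r != 0, is_inv (psi (iota r)) y & b = psi a * y] &
      forall a : A, psi a = 0 <-> exists r : R, r != 0 /\ a * iota r = 0].

Definition monom (A : nzRingType) (n : nat) (x : 'I_n -> A) (alpha : {ffun 'I_n -> nat}) : A :=
  \prod_(i < n) x i ^+ alpha i.

Definition skew_PBW (R A : nzRingType) (n : nat) (iota : {rmorphism R -> A})
    (x : 'I_n -> A) : Prop :=
  [/\ injective iota,
      (forall a : A, exists s : seq ({ffun 'I_n -> nat} * R),
         a = \sum_(p <- s) iota p.2 * monom x p.1),
      (forall (s : seq {ffun 'I_n -> nat}) (c : {ffun 'I_n -> nat} -> R),
         uniq s -> \sum_(al <- s) iota (c al) * monom x al = 0 ->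
         forall al, al \in s -> c al = 0),
      (forall (i : 'I_n) (r : R), r != 0 ->
         exists c r' : R, c != 0 /\ x i * iota r - iota c * x i = iota r') &
      (forall i j : 'I_n, exists c : R, c != 0 /\
         exists (r0 : R) (d : 'I_n -> R),
           x j * x i - iota c * x i * x j = iota r0 + \sum_(k < n) iota (d k) * x k)].

Definition bijective_skew_PBW (R A : nzRingType) (n : nat) (iota : {rmorphism R -> A})
    (x : 'I_n -> A) : Prop :=
  [/\ skew_PBW iota x,
      (exists sigma : 'I_n -> R -> R,
         (forall i r, exists d : R, x i * iota r = iota (sigma i r) * x i + iota d) /\
         (forall i, bijective (sigma i))) &
      (exists c : 'I_n -> 'I_n -> R,
         forall i j : 'I_n,
           [/\ c i j != 0,
               exists (r0 : R) (d : 'I_n -> R),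
                 x j * x i - iota (c i j) * x i * x j = iota r0 + \sum_(k < n) iota (d k) * x k
             & (i < j)%N -> invertible (c i j)])].

Definition ring_iso (Q Q' : nzRingType) : Prop :=
  exists f : {rmorphism Q -> Q'}, bijective f.

(* Main.v *)
Require Import Defs.
From HB Require Import structures.
From mathcomp Require Import all_boot all_order all_algebra.
From mathcomp Require Import boolp zify.
Set Implicit Arguments.
Unset Strict Implicit.
Unset Printing Implicit Defensive.
Import GRing.Theory.
Local Open Scope ring_scope.

(** Give x_i a weight w_i > 0 with w_k < w_i + w_j for all i, j, k. Straightening
    shows x^a r x^b = c x^(a+b) modulo terms of smaller weight, with c != 0 when
    r != 0. Choosing w injective on the exponents of two given elements, the leading
    term of their product is nonzero, so A is a domain.

    Left Ore condition: with all weights 1, let N(d) be the number of monomials of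
    degree < d. If a, s != 0 have degree <= k, the 2 N(d) elements x^a a, x^a s
    (deg x^a < d) lie in a free left R-module of rank N(d + k). As N grows
    polynomially, N(d + k) < 2 N(d) for some d, and over a left Ore domain more
    vectors than coordinates are linearly dependent; this gives p a = q s with
    p != 0. On the right the same argument runs in the converse rings, because
    bijectivity of the sigma_i makes the left and right spans of the monomials of
    bounded weight coincide.

    The ring of left fractions of a left Ore domain consists of the left linear
    partial maps defined on nonzero left ideals, up to agreement on common domains.
    A ring of fractions of S^-1 A is also one of A, and any two of them are
    isomorphic by matching fractions s^-1 a. *)

Lemma domain_mulf_neq0 (T : nzRingType) (a b : T) :
  is_domain T -> a != 0 -> b != 0 -> a * b != 0.
Proof.
move=> domT a0 b0; apply/eqP => /domT [] /eqP; first by rewrite (negbTE a0).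
by rewrite (negbTE b0).
Qed.

Lemma domain_mulfI (T : nzRingType) (a : T) :
  is_domain T -> a != 0 -> injective ( *%R a).
Proof.
move=> domT a0 b c eq_ab.
have /domT [a_0|/subr0_eq //] : a * (b - c) = 0 by rewrite mulrBr eq_ab subrr.
by rewrite a_0 eqxx in a0.
Qed.

(** * The division ring of left fractions of a left Ore domain *)

Section PartialMaps.
Variables (D : nzRingType) (oreD : left_Ore_domain D).
Local Open Scope quotient_scope.

Let domD : is_domain D := oreD.1.

(* The fraction s^-1 a is encoded as the class of the left linear partial map
   sending s to a, i.e. right multiplication by s^-1 a; partial maps are
   identified when they agree on their common domain.  In a left Ore domain
   [pdom_dense] just says that the left ideal [pdom] is nonzero. [pfun] is junk
   outside [pdom]. *)
Record pmap := PMap {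
  pdom : D -> Prop;
  pfun : D -> D;
  pdomD : forall x y, pdom x -> pdom y -> pdom (x + y);
  pdomM : forall a x, pdom x -> pdom (a * x);
  pdom_dense : forall y, exists2 s, s != 0 & pdom (s * y);
  pfunD : forall x y, pdom x -> pdom y -> pfun (x + y) = pfun x + pfun y;
  pfunM : forall a x, pdom x -> pfun (a * x) = a * pfun x
}.

HB.instance Definition _ := gen_eqMixin pmap.
HB.instance Definition _ := gen_choiceMixin pmap.

Implicit Types f g h : pmap.

Lemma pfunN f x : pdom f x -> pfun f (- x) = - pfun f x.
Proof. by move=> fx; rewrite -mulN1r pfunM // mulN1r. Qed.

Lemma pdom2_dense f g y : exists2 s, s != 0 & pdom f (s * y) /\ pdom g (s * y).
Proof.
have [s s0 fs] := pdom_dense f y; have [t t0 gt] := pdom_dense g (s * y).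
exists (t * s); first exact: domain_mulf_neq0.
by rewrite -mulrA; split; [apply: pdomM|].
Qed.

Definition pagree f g : Prop := forall x, pdom f x -> pdom g x -> pfun f x = pfun g x.

(** The point [x] may lie outside the domain of [g], but some nonzero multiple [s * x] lies inside;
    the comparison is made there and [s] cancels. *)
Lemma pagree_trans f g h : pagree f g -> pagree g h -> pagree f h.
Proof.
move=> fg gh x fx hx; have [s s0 gs] := pdom_dense g x.
apply: (domain_mulfI domD s0); rewrite -!pfunM //.
have fs := pdomM s fx; have hs := pdomM s hx.
by rewrite fg ?gh.
Qed.

Definition pequiv f g : bool := `[< pagree f g >].

Lemma pequiv_refl : reflexive pequiv.
Proof. by move=> f; apply/asboolP => x. Qed.

Lemma pequiv_sym : symmetric pequiv.
Proof. by move=> f g; apply/asboolP/asboolP => fg x fx gx; rewrite fg. Qed.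

Lemma pequiv_trans : transitive pequiv.
Proof.
move=> g f h /asboolP fg /asboolP gh; apply/asboolP.
exact: pagree_trans fg gh.
Qed.

Canonical pequiv_rel := EquivRel pequiv pequiv_refl pequiv_sym pequiv_trans.

Definition left_fractions := {eq_quot pequiv_rel}.
HB.instance Definition _ : EqQuotient _ pequiv_rel left_fractions :=
  EqQuotient.on left_fractions.
HB.instance Definition _ := Choice.on left_fractions.

Lemma eq_fractions f g : pagree f g -> \pi_left_fractions f = \pi_left_fractions g.
Proof. by move=> fg; apply/eqmodP/asboolP. Qed.

Lemma fractions_agree f g : \pi_left_fractions f = \pi_left_fractions g -> pagree f g.
Proof. by move/eqmodP/asboolP. Qed.

Program Definition pmul_right (a : D) : pmap :=
  @PMap (fun=> True) (fun x => x * a) _ _ _ _ _.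
Next Obligation. by exists 1; rewrite ?oner_neq0. Qed.
Next Obligation. by rewrite mulrDl. Qed.
Next Obligation. by rewrite mulrA. Qed.

Program Definition popp f : pmap :=
  @PMap (pdom f) (fun x => - pfun f x) _ _ _ _ _.
Next Obligation. exact: pdomD. Qed.
Next Obligation. exact: pdomM. Qed.
Next Obligation. exact: pdom_dense. Qed.
Next Obligation. by rewrite pfunD // opprD. Qed.
Next Obligation. by rewrite pfunM // mulrN. Qed.

Program Definition padd f g : pmap :=
  @PMap (fun x => pdom f x /\ pdom g x) (fun x => pfun f x + pfun g x) _ _ _ _ _.
Next Obligation. by split; apply: pdomD. Qed.
Next Obligation. by split; apply: pdomM. Qed.
Next Obligation. exact: pdom2_dense. Qed.
Next Obligation. by rewrite !pfunD // addrACA. Qed.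
Next Obligation. by rewrite !pfunM // mulrDr. Qed.

(** The map [f] is applied first, so that right multiplications by [a] and then [b] compose to right
    multiplication by [a * b]. *)
Program Definition pcomp f g : pmap :=
  @PMap (fun x => pdom f x /\ pdom g (pfun f x)) (fun x => pfun g (pfun f x)) _ _ _ _ _.
Next Obligation. by rewrite pfunD //; split; apply: pdomD. Qed.
Next Obligation. by rewrite pfunM //; split; apply: pdomM. Qed.
Next Obligation.
have [s s0 fs] := pdom_dense f y; have [t t0 gt] := pdom_dense g (pfun f (s * y)).
exists (t * s); first exact: domain_mulf_neq0.
by rewrite -mulrA pfunM //; split=> //; apply: pdomM.
Qed.
Next Obligation. by rewrite !pfunD. Qed.
Next Obligation. by rewrite !pfunM. Qed.

Definition fadd := lift_op2 left_fractions padd.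
Definition fopp := lift_op1 left_fractions popp.
Definition fmul := lift_op2 left_fractions pcomp.
Definition fembed (a : D) : left_fractions := \pi_left_fractions (pmul_right a).

Lemma repr_agree f : pagree (repr (\pi_left_fractions f)) f.
Proof. by apply: fractions_agree; rewrite reprK. Qed.

Lemma pi_fadd : {morph \pi_left_fractions : f g / padd f g >-> fadd f g}.
Proof.
move=> f g; unlock fadd; apply: eq_fractions => x /= [fx gx] [fx' gx'].
by rewrite !repr_agree.
Qed.

Lemma pi_fopp : {morph \pi_left_fractions : f / popp f >-> fopp f}.
Proof.
by move=> f; unlock fopp; apply: eq_fractions => x /= fx fx'; rewrite repr_agree.
Qed.

Lemma pi_fmul : {morph \pi_left_fractions : f g / pcomp f g >-> fmul f g}.
Proof.
move=> f g; unlock fmul; apply: eq_fractions => x /= [fx gx] [fx' gx'].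
by rewrite repr_agree // in gx' *; rewrite repr_agree.
Qed.

Fact faddA : associative fadd.
Proof.
move=> u v w; rewrite -[u]reprK -[v]reprK -[w]reprK -!pi_fadd.
by apply: eq_fractions => x _ _ /=; rewrite addrA.
Qed.

Fact faddC : commutative fadd.
Proof.
move=> u v; rewrite -[u]reprK -[v]reprK -!pi_fadd.
by apply: eq_fractions => x _ _ /=; rewrite addrC.
Qed.

Fact fadd0r : left_id (fembed 0) fadd.
Proof.
move=> u; rewrite -[u]reprK -!pi_fadd.
by apply: eq_fractions => x _ _ /=; rewrite mulr0 add0r.
Qed.

Fact faddNr : left_inverse (fembed 0) fopp fadd.
Proof.
move=> u; rewrite -[u]reprK -!pi_fopp -!pi_fadd.
by apply: eq_fractions => x _ _ /=; rewrite mulr0 addNr.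
Qed.

Fact fmulA : associative fmul.
Proof.
by move=> u v w; rewrite -[u]reprK -[v]reprK -[w]reprK -!pi_fmul; apply: eq_fractions.
Qed.

Fact fmul1r : left_id (fembed 1) fmul.
Proof.
move=> u; rewrite -[u]reprK -!pi_fmul.
by apply: eq_fractions => x /=; rewrite mulr1.
Qed.

Fact fmulr1 : right_id (fembed 1) fmul.
Proof.
move=> u; rewrite -[u]reprK -!pi_fmul.
by apply: eq_fractions => x /=; rewrite mulr1.
Qed.

Fact fmulDl : left_distributive fmul fadd.
Proof.
move=> u v w; rewrite -[u]reprK -[v]reprK -[w]reprK -!pi_fadd -!pi_fmul -!pi_fadd.
by apply: eq_fractions => x /= _ [[? ?] [? ?]]; rewrite pfunD.
Qed.

Fact fmulDr : right_distributive fmul fadd.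
Proof.
move=> u v w; rewrite -[u]reprK -[v]reprK -[w]reprK -!pi_fadd -!pi_fmul -!pi_fadd.
exact: eq_fractions.
Qed.

Lemma fembed_inj : injective fembed.
Proof. by move=> a b /fractions_agree/(_ 1 I I) /=; rewrite !mul1r. Qed.

Fact fembed1_neq0 : fembed 1 != fembed 0.
Proof. by apply/eqP => /fembed_inj/eqP; rewrite oner_eq0. Qed.

HB.instance Definition _ := GRing.isNzRing.Build left_fractions
  faddA faddC fadd0r faddNr fmulA fmul1r fmulr1 fmulDl fmulDr fembed1_neq0.

Fact fembed_zmod_morphism : zmod_morphism fembed.
Proof.
move=> a b; rewrite /fembed; change (fembed (a - b) = fadd (fembed a) (fopp (fembed b))).
rewrite -pi_fopp -pi_fadd.
by apply: eq_fractions => x _ _ /=; rewrite mulrBr.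
Qed.

Fact fembed_monoid_morphism : monoid_morphism fembed.
Proof.
split=> // a b; change (fembed (a * b) = fmul (fembed a) (fembed b)).
by rewrite -pi_fmul; apply: eq_fractions => x _ _ /=; rewrite mulrA.
Qed.

HB.instance Definition _ := GRing.isZmodMorphism.Build D left_fractions fembed
  fembed_zmod_morphism.
HB.instance Definition _ := GRing.isMonoidMorphism.Build D left_fractions fembed
  fembed_monoid_morphism.

(** For nonzero [s] this exhibits the class of [f] as the fraction with denominator [s] and
    numerator [pfun f s]. *)
Lemma fembedMpi f s : pdom f s -> fembed s * \pi_left_fractions f = fembed (pfun f s).
Proof.
move=> fs; change (fmul (fembed s) (\pi_left_fractions f) = fembed (pfun f s)).
by rewrite -pi_fmul; apply: eq_fractions => x /= _ _; rewrite pfunM.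
Qed.

(** A partial map killing one nonzero [s] kills its whole domain: the Ore condition gives
    [t * x = a * s] with [t] nonzero, hence [t * pfun f x = 0]. *)
Lemma pfun_neq0 f s : \pi_left_fractions f != 0 -> s != 0 -> pdom f s -> pfun f s != 0.
Proof.
move=> f0 s0 fs; apply: contraNneq f0 => fs0; apply/eqP/eq_fractions => x /= fx _.
have [a [t [t0 tx]]] := oreD.2 x s s0.
by apply: (domain_mulfI domD t0); rewrite -pfunM // tx pfunM // fs0 !mulr0.
Qed.

Lemma pfun_inj f x y : \pi_left_fractions f != 0 -> pdom f x -> pdom f y ->
  pfun f x = pfun f y -> x = y.
Proof.
move=> f0 fx fy fxy; apply: subr0_eq; apply/eqP; apply: contraT => xy0.
have fNy : pdom f (- y) by rewrite -mulN1r; apply: pdomM.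
have := pfun_neq0 f0 xy0 (pdomD fx fNy).
by rewrite pfunD // pfunN // fxy subrr eqxx.
Qed.

(** A nonzero class comes from an injective [f]; its inverse is the inverse partial map, defined on
    the image of [f]. *)
Lemma left_fractions_division : division_ring left_fractions.
Proof.
move=> q; rewrite -[q]reprK; move: (repr q) => f f0.
(* The value 0 off the image is junk, like [pfun] outside [pdom]. *)
pose inv y := if pselect (exists2 x, pdom f x & pfun f x = y) is left e
  then s2val (cid2 e) else 0.
have invK x : pdom f x -> inv (pfun f x) = x.
  move=> fx; rewrite /inv; case: pselect => [e|[]]; last by exists x.
  by case: cid2 => z /= fz /(pfun_inj f0) ->.
pose im y := exists2 x, pdom f x & pfun f x = y.
have imD y z : im y -> im z -> im (y + z).
  by case=> [u fu <-] [v fv <-]; exists (u + v); rewrite ?pfunD //; apply: pdomD.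
have imM a y : im y -> im (a * y).
  by case=> [u fu <-]; exists (a * u); rewrite ?pfunM //; apply: pdomM.
(* The Ore condition, applied to [y] and one nonzero value of [f], puts a nonzero multiple of [y]
   among the multiples of that value. *)
have im_dense y : exists2 s, s != 0 & im (s * y).
  have [t t0 ft] := pdom_dense f 1; rewrite mulr1 in ft.
  have [a [s [s0 sy]]] := oreD.2 y _ (pfun_neq0 f0 t0 ft).
  by exists s => //; rewrite sy; apply: imM; exists t.
have invD y z : im y -> im z -> inv (y + z) = inv y + inv z.
  by case=> [u fu <-] [v fv <-]; rewrite -pfunD ?invK //; apply: pdomD.
have invM a y : im y -> inv (a * y) = a * inv y.
  by case=> [u fu <-]; rewrite -pfunM ?invK //; apply: pdomM.
exists (\pi_left_fractions (PMap imD imM im_dense invD invM)); split.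
  change (fmul (\pi_left_fractions f) (\pi_left_fractions (PMap imD imM im_dense invD invM)) = fembed 1).
  rewrite -pi_fmul; apply: eq_fractions => x /= [fx _] _.
  by rewrite invK // mulr1.
change (fmul (\pi_left_fractions (PMap imD imM im_dense invD invM)) (\pi_left_fractions f) = fembed 1).
rewrite -pi_fmul; apply: eq_fractions => y /= [[x fx <-] _] _.
by rewrite invK // mulr1.
Qed.

Lemma left_fractions_total : left_total_fractions fembed.
Proof.
split; [exact: left_fractions_division|exact: fembed_inj|move=> q].
rewrite -[q]reprK; move: (repr q) => f.
have [s s0 fs] := pdom_dense f 1; rewrite mulr1 in fs.
have [y sy] : invertible (fembed s).
  by apply: left_fractions_division; rewrite -(rmorph0 fembed) (inj_eq fembed_inj).
by exists s, (pfun f s), y; split=> //=; rewrite -fembedMpi // mulrA sy.2 mul1r.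
Qed.

End PartialMaps.

Lemma exists_left_total_fractions (D : nzRingType) : left_Ore_domain D ->
  exists (Q : nzRingType) (phi : {rmorphism D -> Q}), left_total_fractions phi.
Proof.
by move=> oreD; exists (left_fractions oreD), (fembed oreD); apply: left_fractions_total.
Qed.

(** * Uniqueness of the ring of fractions *)

Lemma division_ring_mulfI (T : nzRingType) (a : T) :
  division_ring T -> a != 0 -> injective ( *%R a).
Proof.
by move=> divT /divT [b [_ ba]] u v /(congr1 ( *%R b)); rewrite !mulrA ba !mul1r.
Qed.

(** Nonzero denominators are invertible in [Q], so clearing them loses nothing and avoids carrying
    explicit inverses. *)
Lemma left_total_fractionsP (A Q : nzRingType) (phi : {rmorphism A -> Q}) :
  left_total_fractions phi <->
  [/\ division_ring Q, injective phi &
      forall q, exists s a, s != 0 /\ phi s * q = phi a].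
Proof.
split=> -[divQ inj_phi fracQ]; split=> // q.
  have [s [a [y [s0 [sy _] ->]]]] := fracQ q.
  by exists s, a; rewrite mulrA sy mul1r.
have [s [a [s0 sq]]] := fracQ q.
have [y [sy ys]] : invertible (phi s).
  by apply: divQ; rewrite -(rmorph0 phi) (inj_eq inj_phi).
by exists s, a, y; rewrite -sq mulrA ys mul1r.
Qed.

(** The graph of the future isomorphism: both elements are represented by the same denominator and
    numerator. *)
Definition same_fraction (A Q Q' : nzRingType) (phi : {rmorphism A -> Q})
    (phi' : {rmorphism A -> Q'}) (q : Q) (q' : Q') : Prop :=
  exists s a, [/\ s != 0, phi s * q = phi a & phi' s * q' = phi' a].

Section SameFraction.
Variables (A Q Q' : nzRingType) (phi : {rmorphism A -> Q}) (phi' : {rmorphism A -> Q'}).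
Hypotheses (oreA : left_Ore_domain A) (phiT : left_total_fractions phi).
Hypothesis phiT' : left_total_fractions phi'.

Local Notation same := (same_fraction phi phi').

Lemma same_fraction_sym q q' : same q q' -> same_fraction phi' phi q' q.
Proof. by case=> s [a [s0 sq sq']]; exists s, a. Qed.

Lemma same_fraction_total q : exists q', same q q'.
Proof.
have [_ _ /(_ q) [s [a [s0 sq]]]] := (left_total_fractionsP _).1 phiT.
have [divQ' inj_phi' _] := phiT'.
have [y [sy ys]] : invertible (phi' s).
  by apply: divQ'; rewrite -(rmorph0 phi') (inj_eq inj_phi').
by exists (y * phi' a), s, a; rewrite mulrA sy mul1r.
Qed.

(** Over a common left multiple of [s1] and [s2] the two numerators agree, because both represent
    [q] and [phi] is injective. *)
Lemma same_fraction_functional q q1 q2 : same q q1 -> same q q2 -> q1 = q2.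
Proof.
case=> s1 [a1 [s10 s1q s1q1]] [s2 [a2 [s20 s2q s2q2]]].
have [[divQ' inj_phi' _] [_ inj_phi _]] := (phiT', phiT).
have [t2 [t1 [t10 ts]]] := oreA.2 s1 s2 s20.
have ts0 : phi' (t1 * s1) != 0.
  by rewrite -(rmorph0 phi') (inj_eq inj_phi') (domain_mulf_neq0 oreA.1).
have ta : t1 * a1 = t2 * a2.
  by apply: inj_phi; rewrite !rmorphM -s1q -s2q !mulrA -!rmorphM ts.
apply: (division_ring_mulfI divQ' ts0); rewrite {2}ts !rmorphM -!mulrA.
by rewrite s1q1 s2q2 -!rmorphM ta.
Qed.

Lemma same_fractionB q1 q1' q2 q2' :
  same q1 q1' -> same q2 q2' -> same (q1 - q2) (q1' - q2').
Proof.
case=> s1 [a1 [s10 s1q s1q']] [s2 [a2 [s20 s2q s2q']]].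
have [t2 [t1 [t10 ts]]] := oreA.2 s1 s2 s20.
exists (t1 * s1), (t1 * a1 - t2 * a2); split; first exact: domain_mulf_neq0 oreA.1 t10 s10.
  by rewrite mulrBr {2}ts rmorphB !rmorphM -!mulrA s1q s2q.
by rewrite mulrBr {2}ts rmorphB !rmorphM -!mulrA s1q' s2q'.
Qed.

(** With [t * a1 = b * s2], the product of [s1^-1 a1] and [s2^-1 a2] is [(t s1)^-1 (b a2)]. *)
Lemma same_fractionM q1 q1' q2 q2' :
  same q1 q1' -> same q2 q2' -> same (q1 * q2) (q1' * q2').
Proof.
case=> s1 [a1 [s10 s1q s1q']] [s2 [a2 [s20 s2q s2q']]].
have [b [t [t0 ta]]] := oreA.2 a1 s2 s20.
exists (t * s1), (b * a2); split; first exact: domain_mulf_neq0 oreA.1 t0 s10.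
  rewrite rmorphM -mulrA (mulrA (phi s1)) s1q mulrA -rmorphM ta.
  by rewrite !rmorphM -mulrA s2q.
rewrite rmorphM -mulrA (mulrA (phi' s1)) s1q' mulrA -rmorphM ta.
by rewrite !rmorphM -mulrA s2q'.
Qed.

End SameFraction.

Lemma left_total_fractions_unique (A Q Q' : nzRingType)
    (phi : {rmorphism A -> Q}) (phi' : {rmorphism A -> Q'}) :
  left_Ore_domain A -> left_total_fractions phi -> left_total_fractions phi' ->
  ring_iso Q Q'.
Proof.
move=> oreA phiT phiT'.
pose f q := proj1_sig (cid (same_fraction_total phiT phiT' q)).
have fP q : same_fraction phi phi' q (f q) by rewrite /f; case: cid.
pose g q := proj1_sig (cid (same_fraction_total phiT' phiT q)).
have gP q : same_fraction phi' phi q (g q) by rewrite /g; case: cid.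
have f_eq q q' : same_fraction phi phi' q q' -> f q = q'.
  exact: same_fraction_functional (fP q).
have fB : zmod_morphism f.
  by move=> p q; apply: f_eq; apply: same_fractionB.
have fM : monoid_morphism f.
  split; last by move=> p q; apply: f_eq; apply: same_fractionM.
  by apply: f_eq; exists 1, 1; rewrite !rmorph1 !mulr1 oner_neq0.
pose fA := GRing.isZmodMorphism.Build Q Q' f fB.
pose fR := GRing.isMonoidMorphism.Build Q Q' f fM.
pose F : {rmorphism Q -> Q'} := HB.pack f fA fR.
exists F, g => q /=.
  apply: (same_fraction_functional oreA phiT' phiT (gP _)).
  exact: same_fraction_sym.
exact/f_eq/same_fraction_sym.
Qed.

(** Write [q = s^-1 b] with [s = r1^-1 a1] and [b = r2^-1 a2] in the localization. A common multiple
    [t1 * r1 = t2 * r2] in [R] gives [q] the denominator [t1 a1] and the numerator [t2 a2], both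
    from [A]. *)
Lemma left_total_fractions_localization (R A B Q : nzRingType) (iota : {rmorphism R -> A})
    (psi : {rmorphism A -> B}) (phi : {rmorphism B -> Q}) :
  injective iota -> left_Ore_domain R -> left_Ore_domain A -> left_localization iota psi ->
  left_total_fractions phi -> left_total_fractions (phi \o psi).
Proof.
move=> inj_iota oreR oreA [invB fracB kerB] /left_total_fractionsP [divQ inj_phi fracQ].
have fracB' b : exists (r : R) (a : A), r != 0 /\ psi (iota r) * b = psi a.
  have [r [a [y [r0 [ry _] ->]]]] := fracB b.
  by exists r, a; rewrite mulrA ry mul1r.
have iota_neq0 r : r != 0 -> iota r != 0.
  by rewrite -(rmorph0 iota) (inj_eq inj_iota).
(* An element of the kernel is killed by a nonzero element of [R], hence vanishes in the domain
   [A]. *)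
have psi_inj : injective psi.
  move=> a b /eqP; rewrite -subr_eq0 -rmorphB => /eqP /kerB [r [/iota_neq0 r0 rab]].
  by case: (oreA.1 _ _ rab) => [/eqP|/subr0_eq //]; rewrite (negbTE r0).
apply/left_total_fractionsP; split=> //; first exact: inj_comp.
move=> q; have [s [b [s0 sq]]] := fracQ q.
have [r1 [a1 [r10 r1s]]] := fracB' s; have [r2 [a2 [r20 r2b]]] := fracB' b.
have [t2 [t1 [t10 tr]]] := oreR.2 r1 r2 r20.
have a10 : a1 != 0.
  have [y [_ yr1]] := invB _ r10.
  apply: contraNneq s0 => a1_0; move: r1s; rewrite a1_0 rmorph0.
  by move/(congr1 ( *%R y)); rewrite mulrA yr1 mul1r mulr0 => ->.
exists (iota t1 * a1), (iota t2 * a2); split.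
  exact: domain_mulf_neq0 oreA.1 (iota_neq0 _ t10) a10.
rewrite /= !(rmorphM psi) -r1s -r2b (mulrA _ _ s) (mulrA _ _ b) -!(rmorphM psi).
by rewrite -!(rmorphM iota) tr !(rmorphM phi) -mulrA sq.
Qed.

(** * Passage to the converse ring *)

Section Converse.
Variables (A B : nzRingType) (f : {rmorphism A -> B}).

Let fc : A^c -> B^c := f.

Fact conv_zmod_morphism : zmod_morphism fc.
Proof. by move=> a b; apply: (rmorphB f a b). Qed.

Fact conv_monoid_morphism : monoid_morphism fc.
Proof. by split=> [|a b]; [apply: (rmorph1 f)|apply: (rmorphM f b a)]. Qed.

Definition conv_rmorphism : {rmorphism A^c -> B^c} :=
  HB.pack fc
    (GRing.isZmodMorphism.Build A^c B^c fc conv_zmod_morphism)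
    (GRing.isMonoidMorphism.Build A^c B^c fc conv_monoid_morphism).

End Converse.

Lemma conv_is_domain (T : nzRingType) : is_domain T -> is_domain T^c.
Proof. by move=> domT a b /(domT b a) []; [right|left]. Qed.

Lemma conv_right_Ore_domain (T : nzRingType) :
  right_Ore_domain T -> left_Ore_domain T^c.
Proof. by case=> domT oreT; split; [apply: conv_is_domain|]. Qed.

Lemma right_Ore_domain_conv (T : nzRingType) :
  left_Ore_domain T^c -> right_Ore_domain T.
Proof.
case=> domT oreT; split=> // a b ab0.
by have [] := domT b a ab0; [right|left].
Qed.

Lemma conv_is_inv (T : nzRingType) (u v : T) :
  is_inv u v -> @is_inv T^c u v.
Proof. by case. Qed.

Lemma conv_invertible (T : nzRingType) (u : T) :
  invertible u -> @invertible T^c u.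
Proof. by case=> v uv; exists v; apply: conv_is_inv. Qed.

Lemma conv_division_ring (T : nzRingType) : division_ring T -> division_ring T^c.
Proof. by move=> divT q q0; apply/conv_invertible/divT. Qed.

Lemma conv_right_total_fractions (D Q : nzRingType) (phi : {rmorphism D -> Q}) :
  right_total_fractions phi -> left_total_fractions (conv_rmorphism phi).
Proof.
case=> divQ inj_phi fracQ; split=> // [|q]; first exact: conv_division_ring.
have [s [a [y [s0 sy qE]]]] := fracQ q.
by exists s, a, y; split=> //; apply: conv_is_inv.
Qed.

Lemma conv_right_localization (R A B : nzRingType) (iota : {rmorphism R -> A})
    (psi : {rmorphism A -> B}) :
  right_localization iota psi ->
  left_localization (conv_rmorphism iota) (conv_rmorphism psi).
Proof.
case=> invB fracB kerB; split=> // [r r0|b]; first exact/conv_invertible/invB.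
have [r [a [y [r0 ry bE]]]] := fracB b.
by exists r, a, y; split=> //; apply: conv_is_inv.
Qed.

Section ConverseBack.
Variables (A Q : nzRingType) (phi : {rmorphism A^c -> Q}).

Let phic : A -> Q^c := phi.

Fact rmorphism_conv_zmod : zmod_morphism phic.
Proof. by move=> a b; apply: (rmorphB phi a b). Qed.

Fact rmorphism_conv_monoid : monoid_morphism phic.
Proof. by split=> [|a b]; [apply: (rmorph1 phi)|apply: (rmorphM phi b a)]. Qed.

(** Here the target is reversed instead of the source, which transports a ring of fractions built
    for [A^c] back to [A]. *)
Definition rmorphism_conv : {rmorphism A -> Q^c} :=
  HB.pack phic
    (GRing.isZmodMorphism.Build A Q^c phic rmorphism_conv_zmod)
    (GRing.isMonoidMorphism.Build A Q^c phic rmorphism_conv_monoid).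

Lemma right_total_fractions_conv :
  left_total_fractions phi -> right_total_fractions rmorphism_conv.
Proof.
case=> divQ inj_phi fracQ; split=> // [|q]; first exact: conv_division_ring.
have [s [a [y [s0 sy qE]]]] := fracQ q.
by exists s, a, y; split=> //; apply: conv_is_inv.
Qed.

End ConverseBack.

Lemma ring_iso_conv (Q Q' : nzRingType) : ring_iso Q^c Q'^c -> ring_iso Q Q'.
Proof.
case=> f [g fK gK]; pose h : Q -> Q' := f.
have hB : zmod_morphism h by move=> a b; apply: (rmorphB f a b).
have hM : monoid_morphism h.
  by split=> [|a b]; [apply: (rmorph1 f)|apply: (rmorphM f b a)].
pose hZ := GRing.isZmodMorphism.Build Q Q' h hB.
pose hR := GRing.isMonoidMorphism.Build Q Q' h hM.
pose H : {rmorphism Q -> Q'} := HB.pack h hZ hR.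
by exists H, g.
Qed.

Lemma exists_right_total_fractions (D : nzRingType) : right_Ore_domain D ->
  exists (Q : nzRingType) (phi : {rmorphism D -> Q}), right_total_fractions phi.
Proof.
move=> /conv_right_Ore_domain /exists_left_total_fractions [Q [phi phiT]].
by exists Q^c, (rmorphism_conv phi); apply: right_total_fractions_conv.
Qed.

(** Composed with [psi], the ring [Q'] is a ring of fractions of [A] as well, and uniqueness
    applies. *)
Lemma left_fractions_of_localization (R A B Q Q' : nzRingType) (iota : {rmorphism R -> A})
    (psi : {rmorphism A -> B}) (phi : {rmorphism A -> Q}) (phi' : {rmorphism B -> Q'}) :
  injective iota -> left_Ore_domain R -> left_Ore_domain A -> left_localization iota psi ->
  left_total_fractions phi -> left_total_fractions phi' -> ring_iso Q Q'.
Proof.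
move=> inj_iota oreR oreA psiL phiT phiT'.
apply: (left_total_fractions_unique oreA phiT).
exact: left_total_fractions_localization psiL phiT'.
Qed.

Lemma right_fractions_of_localization (R A B Q Q' : nzRingType) (iota : {rmorphism R -> A})
    (psi : {rmorphism A -> B}) (phi : {rmorphism A -> Q}) (phi' : {rmorphism B -> Q'}) :
  injective iota -> right_Ore_domain R -> right_Ore_domain A -> right_localization iota psi ->
  right_total_fractions phi -> right_total_fractions phi' -> ring_iso Q Q'.
Proof.
move=> inj_iota /conv_right_Ore_domain oreR /conv_right_Ore_domain oreA.
move=> /conv_right_localization psiL /conv_right_total_fractions phiT.
move=> /conv_right_total_fractions phiT'; apply: ring_iso_conv.
exact: (@left_fractions_of_localization R^c A^c B^c Q^c Q'^c) psiL phiT phiT'.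
Qed.

(** * The left Ore condition from polynomial growth *)

(* Gaussian elimination, the left Ore condition replacing division by the pivot. *)
Lemma left_Ore_dependence (R : nzRingType) (J T : eqType) (L : seq T) (s : seq J)
    (v : J -> T -> R) :
  left_Ore_domain R -> uniq s -> (size L < size s)%N ->
  exists c : J -> R, (exists2 j, j \in s & c j != 0) /\
    forall t, t \in L -> \sum_(j <- s) c j * v j t = 0.
Proof.
move=> oreR; elim: L s v => [|t L IHL] s v uniq_s lt_s /=.
  exists (fun=> 1); split=> //; case: s lt_s {uniq_s} => // j s _.
  by exists j; rewrite ?mem_head ?oner_neq0.
case: (boolP (has (fun j => v j t != 0) s)) => [/hasP [j0 s_j0 v0]|/hasPn v0]; last first.
  have [c [c_neq0 cP]] := IHL s v uniq_s (ltnW lt_s); exists c; split=> // u.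
  rewrite inE => /orP [/eqP ->|/cP //]; apply: big1_seq => j /andP [_ /v0].
  by rewrite negbK => /eqP ->; rewrite mulr0.
have /choice [ab abP] j : exists ab : R * R, ab.2 != 0 /\ ab.2 * v j t = ab.1 * v j0 t.
  by have [a [b [? ?]]] := oreR.2 (v j t) _ v0; exists (a, b).
(* Row [j], scaled by a nonzero factor, minus the multiple of the pivot row that clears column
   [t]. *)
pose u j i := (ab j).2 * v j i - (ab j).1 * v j0 i.
have [||c [[j s_j c_j] cP]] := IHL (rem j0 s) u; first exact: rem_uniq.
  by rewrite size_rem // -ltnS (leq_trans lt_s) ?leqSpred.
rewrite (mem_rem_uniq _ uniq_s) in s_j; case/andP: s_j => j_neq s_j.
(* Expressing the rows [u] through the rows [v] collects all the pivot multiples in the coefficient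
   of [j0]. *)
exists (fun k => if k == j0 then - \sum_(i <- rem j0 s) c i * (ab i).1
                 else c k * (ab k).2); split.
  exists j => //; rewrite (negbTE j_neq); apply: (domain_mulf_neq0 oreR.1 c_j).
  by have [] := abP j.
move=> i Li; rewrite (big_rem j0) //= eqxx mulNr mulr_suml -sumrN -big_split /=.
transitivity (\sum_(k <- rem j0 s) c k * u k i).
  apply: eq_big_seq => k; rewrite (mem_rem_uniq _ uniq_s) => /andP [k_neq _].
  by rewrite (negbTE k_neq) mulrBr !mulrA addrC.
move: Li; rewrite inE => /orP [/eqP ->|/cP //].
by apply: big1 => k _; rewrite /u (abP k).2 subrr mulr0.
Qed.

Lemma linear_lt_exp2 c : exists i, (1 + i * c < 2 ^ i)%N.
Proof.
(* With this exponent the power of 2 is a cube, at least [(c + 2)^3], which exceeds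
   [1 + 3 c (c + 1)]. *)
exists (c.+1 * 3)%N; rewrite expnM.
have : (c.+2 <= 2 ^ c.+1)%N by apply: ltn_expl.
rewrite -(leq_exp2r _ _ (isT : 0 < 3)%N) => /(leq_trans _) -> //.
by rewrite !expnS expn0; nia.
Qed.

Lemma polynomial_lt_exp2 n k : exists j, ((1 + j * k) ^ n < 2 ^ j)%N.
Proof.
case: n => [|n]; first by exists 1%N.
(* Choosing [j = i * n.+1] makes [2 ^ j] an [n.+1]-th power, so a linear bound of slope [n.+1 * k]
   can be raised to that power. *)
have [i lt_i] := linear_lt_exp2 (n.+1 * k)%N; exists (i * n.+1)%N.
by rewrite expnM ltn_exp2r // -mulnA.
Qed.

(** Otherwise each step of length [k] at least doubles [N], so that [N (1 + j * k)] is at least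
    [2 ^ j], against the polynomial bound. *)
Lemma polynomial_growth (N : nat -> nat) n k :
  (0 < N 1)%N -> (forall d, N d <= d ^ n)%N -> exists d, (N (d + k) < 2 * N d)%N.
Proof.
move=> N1 Nle; apply: contrapT => /forallNP Nge.
have Nexp j : (2 ^ j <= N (1 + j * k))%N.
  elim: j => [|j IHj]; first by rewrite mul0n.
  have /negP := Nge (1 + j * k)%N; rewrite -leqNgt => le_N.
  have -> : (1 + j.+1 * k = 1 + j * k + k)%N by lia.
  by apply: leq_trans le_N; rewrite expnS leq_mul2l IHj orbT.
have [j] := polynomial_lt_exp2 n k.
by rewrite ltnNge (leq_trans (Nexp j)).
Qed.

(** * Left linear combinations of a family over a coefficient ring *)

Section Span.
Variables (R A : nzRingType) (iota : {rmorphism R -> A}) (T : eqType) (e : T -> A).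

(** Indices may repeat, so closure properties follow by plain induction; [span_coef] collects the
    coefficients afterwards. *)
Inductive span (P : pred T) : A -> Prop :=
| span0 : span P 0
| span_cons r t a : P t -> span P a -> span P (iota r * e t + a).

Lemma spanD P a b : span P a -> span P b -> span P (a + b).
Proof.
move=> Pa Pb; elim: Pa => [|r t c Pt _ IHc]; first by rewrite add0r.
by rewrite -addrA; apply: span_cons.
Qed.

Lemma span_gen (P : pred T) r t : P t -> span P (iota r * e t).
Proof. by move=> Pt; rewrite -[X in span _ X]addr0; apply: span_cons (span0 P). Qed.

Lemma spanZ P r a : span P a -> span P (iota r * a).
Proof.
move=> Pa; elim: Pa => [|s t c Pt _ IHc]; first by rewrite mulr0; apply: span0.
by rewrite mulrDr mulrA -rmorphM; apply: span_cons.
Qed.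

Lemma spanN P a : span P a -> span P (- a).
Proof. by move=> Pa; rewrite -mulN1r -(rmorph1 iota) -rmorphN; apply: spanZ. Qed.

Lemma spanB P a b : span P a -> span P b -> span P (a - b).
Proof. by move=> Pa Pb; apply: spanD => //; apply: spanN. Qed.

Lemma span_sum P (I : Type) (s : seq I) (F : I -> A) :
  (forall i, span P (F i)) -> span P (\sum_(i <- s) F i).
Proof. by move=> PF; apply: big_ind => //; [apply: span0|apply: spanD]. Qed.

Lemma span_sub (P P' : pred T) a : subpred P P' -> span P a -> span P' a.
Proof.
move=> sPP'; elim=> [|r t b Pt _ IHb]; first exact: span0.
by apply: span_cons => //; apply: sPP'.
Qed.

Lemma span_coef (L : seq T) a : uniq L -> span (mem L) a ->
  exists c : T -> R, a = \sum_(t <- L) iota (c t) * e t.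
Proof.
move=> uniq_L; elim=> [|r t b Lt _ [c ->]].
  by exists (fun=> 0); rewrite big1 // => t _; rewrite rmorph0 mul0r.
exists (fun u => (if u == t then r else 0) + c u).
rewrite (eq_bigr _ (fun u _ => congr1 ( *%R^~ _) (rmorphD iota _ _))).
rewrite (eq_bigr _ (fun u _ => mulrDl _ _ _)) big_split /=; congr (_ + _).
rewrite (big_rem t) //= eqxx big1_seq ?addr0 // => u /andP [_].
by rewrite mem_rem_uniq // => /andP [/negbTE -> _]; rewrite rmorph0 mul0r.
Qed.

Lemma span_finite (P : pred T) a : span P a ->
  exists L, [/\ uniq L, all P L & span (mem L) a].
Proof.
elim=> [|r t b Pt _ [L [uniq_L PL Lb]]]; first by exists [::]; split=> //; apply: span0.
exists (undup (t :: L)); rewrite undup_uniq; split=> //.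
  by apply/allP => u; rewrite mem_undup inE => /orP [/eqP ->//|]; apply: (allP PL).
apply: span_cons; first by change (t \in undup (t :: L)); rewrite mem_undup mem_head.
by apply: span_sub Lb => u Lu; change (u \in undup (t :: L)); rewrite mem_undup mem_behead.
Qed.

End Span.

(** Stated for an arbitrary family [e], so that it serves both for [A] over [R] and for the converse
    rings. *)
Lemma left_Ore_of_growth (R A : nzRingType) (iota : {rmorphism R -> A}) (T : eqType)
    (e : T -> A) (L : nat -> seq T) n :
  left_Ore_domain R -> is_domain A ->
  (forall d, uniq (L d)) -> (forall d d', (d <= d')%N -> {subset L d <= L d'}) ->
  (0 < size (L 1%N))%N -> (forall d, size (L d) <= d ^ n)%N ->
  (forall d (c : T -> R), \sum_(t <- L d) iota (c t) * e t = 0 ->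
     forall t, t \in L d -> c t = 0) ->
  (forall a, exists k, forall d t, t \in L d -> span iota e (mem (L (d + k)%N)) (e t * a)) ->
  left_Ore_domain A.
Proof.
move=> oreR domA uniq_L monoL L1 sizeL free_e filt; split=> // a s s0.
have [ka kaP] := filt a; have [ks ksP] := filt s; pose k := maxn ka ks.
have [d ltd] := polynomial_growth k L1 sizeL.
pose ab (b : bool) := if b then a else s.
have /choice [v vP] (j : bool * T) : exists v : T -> R, j.2 \in L d ->
    e j.2 * ab j.1 = \sum_(t <- L (d + k)%N) iota (v t) * e t.
  case: (boolP (j.2 \in L d)) => [Lj|_]; last by exists (fun=> 0).
  suff /(span_coef (uniq_L _)) [v vE] : span iota e (mem (L (d + k)%N)) (e j.2 * ab j.1).
    by exists v.
  have mono k' : (k' <= k)%N -> subpred (mem (L (d + k')%N)) (mem (L (d + k)%N)).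
    by move=> le_k; apply/monoL; rewrite leq_add2l.
  case: (j.1); first by apply: span_sub (kaP d _ Lj); apply/mono/leq_maxl.
  by apply: span_sub (ksP d _ Lj); apply/mono/leq_maxr.
(* The flag tells the multiples of [a] from those of [s]: twice [size (L d)] vectors in all. *)
pose js := [seq (true, t) | t <- L d] ++ [seq (false, t) | t <- L d].
have [||c [[j js_j c_j] cP]] := left_Ore_dependence (L := L (d + k)%N) (s := js) v oreR.
- rewrite cat_uniq !map_inj_uniq ?uniq_L ?andbT /= => [|t u []//|t u []//].
  by apply/hasPn => j /mapP [t _ ->]; apply/mapP => -[].
- by rewrite size_cat !size_map addnn -mul2n.
pose comb b := \sum_(t <- L d) iota (c (b, t)) * e t.
have sum0 : comb true * a + comb false * s = 0.
  have <- : \sum_(t <- L (d + k)%N) iota (\sum_(j <- js) c j * v j t) * e t = 0.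
    by apply: big1_seq => t /andP [_ /cP ->]; rewrite rmorph0 mul0r.
  under [RHS]eq_bigr do rewrite rmorph_sum mulr_suml.
  rewrite exchange_big big_cat !big_map !mulr_suml /=; congr (_ + _).
    apply: eq_big_seq => t Lt; rewrite -mulrA (vP (true, t) Lt) mulr_sumr.
    by apply: eq_bigr => u _; rewrite rmorphM mulrA.
  apply: eq_big_seq => t Lt; rewrite -mulrA (vP (false, t) Lt) mulr_sumr.
  by apply: eq_bigr => u _; rewrite rmorphM mulrA.
(* If this coefficient vanished, so would [comb false * s], hence [comb false]; freeness would then
   kill every [c j]. *)
have comb_neq0 : comb true != 0.
  apply/eqP => comb0; move: sum0; rewrite comb0 mul0r add0r.
  case/domA => [comb0'|s_0]; last by rewrite s_0 eqxx in s0.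
  move: js_j; rewrite mem_cat => /orP [] /mapP [t Lt jE]; move: c_j; rewrite jE.
    by rewrite (free_e d (fun t => c (true, t)) comb0) ?eqxx.
  by rewrite (free_e d (fun t => c (false, t)) comb0') ?eqxx.
exists (- comb false), (comb true); split=> //.
by rewrite mulNr; apply/eqP; rewrite -addr_eq0 sum0.
Qed.

(** * Exponents and weights *)

(** Reduction modulo [b] reads the lowest digit and division by [b] removes it. The top parts [u]
    and [v] are unrestricted. *)
Lemma digits_inj b m (a c : 'I_m -> nat) u v :
  (forall i, a i < b)%N -> (forall i, c i < b)%N ->
  (\sum_i a i * b ^ i + u * b ^ m = \sum_i c i * b ^ i + v * b ^ m)%N ->
  forall i, a i = c i.
Proof.
elim: m a c => [|m IHm] a c a_b c_b; first by move=> _ [].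
have rec (z : 'I_m.+1 -> nat) w : (\sum_i z i * b ^ i + w * b ^ m.+1 =
    (\sum_i z (lift ord0 i) * b ^ i + w * b ^ m) * b + z ord0)%N.
  rewrite big_ord_recl muln1 mulnDl big_distrl expnSr mulnA /= -addnA addnC.
  congr (_ + _ + _)%N; apply: eq_bigr => i _.
  by rewrite /bump /= add1n expnSr mulnA.
rewrite !rec => eq_ac.
have b0 : (0 < b)%N by apply: leq_ltn_trans (a_b ord0).
have eq0 : a ord0 = c ord0.
  by move/(congr1 (modn^~ b)): eq_ac; rewrite !modnMDl !modn_small.
have eqS : forall i, a (lift ord0 i) = c (lift ord0 i).
  apply: IHm => //; move/(congr1 (divn^~ b)): eq_ac.
  by rewrite !divnMDl // !divn_small // !addn0.
by move=> i; case: (unliftP ord0 i) => [k ->|->].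
Qed.

Section Exponents.
Variable n : nat.
Implicit Types (i j k : 'I_n) (al be : {ffun 'I_n -> nat}).

Definition unit_exp i : {ffun 'I_n -> nat} := [ffun j => nat_of_bool (j == i)].

Lemma add_expE al be i : (al + be) i = (al i + be i)%N.
Proof. by rewrite ffunE. Qed.

Definition weight (w : 'I_n -> nat) al : nat := (\sum_i al i * w i)%N.

Lemma weightD w al be : weight w (al + be) = (weight w al + weight w be)%N.
Proof. by rewrite /weight -big_split; apply: eq_bigr => i _; rewrite add_expE mulnDl. Qed.

Lemma weight0 w : weight w 0 = 0%N.
Proof. by apply: big1 => i _; rewrite ffunE. Qed.

Lemma weight_unit w i : weight w (unit_exp i) = w i.
Proof.
rewrite /weight (bigD1 i) //= ffunE eqxx mul1n big1 ?addn0 // => j /negbTE ji.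
by rewrite ffunE ji.
Qed.

(** Here [j] is the least index in the support of [al], and [be] is [al] with one factor [x_j]
    removed. *)
Lemma exp_case al : al = 0 \/
  exists j be, [/\ al = be + unit_exp j, forall i, (i < j)%N -> be i = 0%N
                 & (weight (fun=> 1%N) be < weight (fun=> 1%N) al)%N].
Proof.
case: (pickP (fun i => al i != 0%N)) => [i0 ali0|al0]; last first.
  by left; apply/ffunP => i; rewrite ffunE; apply/eqP; have /negbFE := al0 i.
right; case: (@arg_minnP _ i0 (fun i => al i != 0%N) (fun i => i) ali0) => j alj minj.
pose be := [ffun i => al i - (i == j)]%N.
have alE : al = be + unit_exp j.
  apply/ffunP => i; rewrite add_expE !ffunE; case: eqP => [->|_] /=; lia.
exists j, be; split=> //.
  move=> i lt_ij; rewrite ffunE; apply/eqP; apply: contraT => ali.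
  have /minj : al i != 0%N by lia.
  by rewrite leqNgt lt_ij.
by rewrite [in X in (_ < X)%N]alE weightD weight_unit addn1.
Qed.

(** Each step prepends a variable that no variable already present precedes, which is the case where
    no straightening occurs. *)
Lemma exp_ind (P : {ffun 'I_n -> nat} -> Prop) : P 0 ->
  (forall j be, (forall i, (i < j)%N -> be i = 0%N) -> P be -> P (be + unit_exp j)) ->
  forall al, P al.
Proof.
move=> P0 PS al; have [m] := ubnP (weight (fun=> 1%N) al).
elim: m al => // m IHm al lt_al.
have [-> //|[j [be [alE be_j lt_be]]]] := exp_case al.
by rewrite alE; apply: PS => //; apply: IHm; apply: leq_trans lt_be _.
Qed.

Section Monomials.
Variables (A : nzRingType) (x : 'I_n -> A).

Lemma monom0 : monom x 0 = 1.
Proof. by apply: big1 => i _; rewrite ffunE. Qed.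

Lemma monom_mul_var j al :
  (forall i, (i < j)%N -> al i = 0%N) -> x j * monom x al = monom x (al + unit_exp j).
Proof.
(* Extending the factors by 1 to all natural indices allows the product to be split at [j]. *)
pose y be (k : nat) := if (insub k : option 'I_n) is Some i then x i ^+ be i else 1.
have monE be : monom x be = \prod_(0 <= k < n) y be k.
  by rewrite big_mkord; apply: eq_bigr => i _; rewrite /y valK.
have splitE be : (forall i, (i < j)%N -> be i = 0%N) ->
    monom x be = y be j * \prod_(j.+1 <= k < n) y be k.
  move=> be_j; rewrite monE (big_cat_nat (n := j)) //=; last exact: ltnW.
  rewrite [X in X * _]big_nat big1 => [|k /= lt_kj]; first by rewrite mul1r big_ltn.
  by rewrite /y; case: insubP => // i _ ik; rewrite be_j ?ik.
move=> al_j; rewrite !splitE //; last first.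
  by move=> i lt_ij; rewrite add_expE al_j // ffunE -val_eqE ltn_eqF.
rewrite mulrA; congr (_ * _).
  by rewrite /y valK add_expE ffunE eqxx addn1 exprS.
apply: eq_big_nat => k /andP [lt_jk _]; rewrite /y; case: insubP => // i _ ik.
by rewrite add_expE ffunE -val_eqE ik gtn_eqF ?addn0.
Qed.

End Monomials.

(* The second condition makes the linear terms of x_j x_i lower than x_i x_j. *)
Definition admissible (w : 'I_n -> nat) : Prop :=
  (forall i, 0 < w i)%N /\ forall i j k, (w k < w i + w j)%N.

(* The weights b^i + b^n read the exponents as digits in a base b exceeding all
   of them. *)
Lemma separating_weight (L : seq {ffun 'I_n -> nat}) :
  exists2 w, admissible w & {in L &, injective (weight w)}.
Proof.
(* The offset 2 puts [b] above every exponent and keeps it above 1 even when all exponents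
   vanish. *)
pose b := (\max_(al <- L) \max_i al i).+2.
have ltb al i : al \in L -> (al i < b)%N.
  move=> Lal; rewrite ltnS; apply: leqW; apply: leq_trans (leq_bigmax_seq _ Lal isT).
  exact: (leq_bigmax (F := fun i => al i)).
exists (fun i => b ^ i + b ^ n)%N.
  split=> [i|i j k]; first by rewrite addn_gt0 expn_gt0.
  (* A single weight stays below [2 b^n], while a sum of two weights exceeds it. *)
  have : (b ^ k < b ^ n)%N by rewrite ltn_exp2l.
  by have := expn_gt0 b i; lia.
move=> al be Lal Lbe eq_w; apply/ffunP.
have weightE ga : weight (fun i => b ^ i + b ^ n)%N ga =
    (\sum_i ga i * b ^ i + \sum_i ga i * b ^ n)%N.
  by rewrite /weight -big_split; apply: eq_bigr => i _; rewrite mulnDr.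
rewrite !weightE -!big_distrl /= in eq_w.
by apply: digits_inj eq_w => i; apply: ltb.
Qed.

End Exponents.

(** * The filtration by weight *)

Section Filtration.
Variables (R A : nzRingType) (n : nat) (iota : {rmorphism R -> A}) (x : 'I_n -> A).
Hypothesis domR : is_domain R.
Hypothesis xr : forall i r, exists c d : R,
  (r != 0 -> c != 0) /\ x i * iota r = iota c * x i + iota d.
Hypothesis xx : forall i j : 'I_n, exists c : R, c != 0 /\
  exists (r0 : R) (d : 'I_n -> R),
    x j * x i - iota c * x i * x j = iota r0 + \sum_(k < n) iota (d k) * x k.

Implicit Types (i j k : 'I_n) (al be ga : {ffun 'I_n -> nat}) (r c : R).

Local Notation mon := (monom x).

Section Weight.
Variable w : 'I_n -> nat.
Hypothesis w_adm : admissible w.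

(** With the strict bound, [F (weight w al)] holds exactly the combinations of terms lower than
    [x^al]. *)
Definition filtration m : A -> Prop := span iota mon (fun al => weight w al < m)%N.

Local Notation F := filtration.

Lemma filtration_le m m' a : (m <= m')%N -> F m a -> F m' a.
Proof. by move=> le_m; apply: span_sub => al lt_al; apply: leq_trans le_m. Qed.

(** The straightening of [x_i x^al], cut off at total weight [m] to allow induction on [m]. *)
Let leads m := forall i al, (weight w al + w i < m)%N ->
  exists c, c != 0 /\
    F (weight w al + w i) (x i * mon al - iota c * mon (al + unit_exp i)).

(** Relative to [leads m], since it is already needed inside the induction proving [leads]. *)
Let leads_mul_var m i m' a : leads m -> F m' a -> (m' + w i <= m)%N ->
  F (m' + w i) (x i * a).
Proof.
move=> Lm + le_m; elim=> [|r al b lt_al _ IHb]; first by rewrite mulr0; apply: span0.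
rewrite mulrDr; apply: spanD => //; have [c [d [_ xrE]]] := xr i r.
rewrite mulrA xrE mulrDl; apply: spanD; last first.
  by apply: span_gen; apply: ltn_addr.
rewrite -mulrA; apply: spanZ.
have lt_ali : (weight w al + w i < m' + w i)%N by rewrite ltn_add2r.
have [c' [_ lead]] := Lm i al (leq_trans lt_ali le_m).
rewrite -(subrK (iota c' * mon (al + unit_exp i)) (x i * mon al)).
apply: spanD; first by apply: filtration_le lead; apply: ltnW.
by apply: span_gen; rewrite weightD weight_unit.
Qed.

(* Moving [x_i] past the first variable [x_j] of [x^al] only creates terms of
   smaller weight, to which the induction hypothesis applies. *)
Let leadsP m : leads m.
Proof.
elim: m => [|m IHm] i al //; rewrite ltnS leq_eqVlt => /orP [/eqP def_m|/IHm //].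
have head be j : (forall k, (k < j)%N -> be k = 0%N) ->
    exists c, c != 0 /\ F (weight w be + w j) (x j * mon be - iota c * mon (be + unit_exp j)).
  move=> be_j; exists 1; split; first exact: oner_neq0.
  by rewrite rmorph1 mul1r monom_mul_var // subrr; apply: span0.
have [al0|[j [be [alE be_j _]]]] := exp_case al.
  by apply: head => k _; rewrite al0 ffunE.
(* For [i <= j] the product is already an ordered monomial. *)
case: (leqP i j) => [le_ij|lt_ji].
  apply: head => k lt_ki; rewrite alE add_expE be_j ?(leq_trans lt_ki) //.
  by rewrite ffunE -val_eqE ltn_eqF ?(leq_trans lt_ki).
have [w_gt0 w_add] := w_adm.
have def_m' : (weight w be + w j + w i = m)%N by rewrite -def_m alE weightD weight_unit.
have ltm k : (w k < w i + w j)%N -> (weight w be + w k < m)%N by lia.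
have monE : mon al = x j * mon be by rewrite alE monom_mul_var.
have [c [c0 [r0 [d /(canRL (subrK _)) xxE]]]] := xx j i.
have [|c' [c'0 lead]] := IHm i be; first by apply: ltm; have := w_gt0 j; lia.
have [c'' [d'' [/(_ c'0) c''0 xc'E]]] := xr j c'.
exists (c * c''); split; first exact: domain_mulf_neq0.
set f := (x i * mon be - _) in lead.
have xiE : x i * mon be = iota c' * mon (be + unit_exp i) + f by rewrite addrC subrK.
have xjE : x j * (iota c' * mon (be + unit_exp i)) =
    iota c'' * mon (al + unit_exp i) + iota d'' * mon (be + unit_exp i).
  rewrite mulrA xc'E mulrDl -mulrA monom_mul_var; first by rewrite alE addrAC.
  by move=> k lt_kj; rewrite add_expE be_j // ffunE -val_eqE ltn_eqF ?(ltn_trans lt_kj).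
(* After [x_i x_j] is rewritten through [x_j x_i] and [x_i] moved into [x^be], the leading terms
   cancel. What remains is the linear part of the exchange, the derivation term [d''] and the
   earlier remainder [f]. *)
have -> : x i * mon al - iota (c * c'') * mon (al + unit_exp i) =
    (iota r0 + \sum_k iota (d k) * x k) * mon be +
    iota c * (iota d'' * mon (be + unit_exp i) + x j * f).
  rewrite monE mulrA xxE mulrDl -!mulrA xiE (mulrDr (x j)) xjE -(addrA (iota c'' * _)).
  by rewrite (mulrDr (iota c) (iota c'' * _)) [iota (c * _)]rmorphM -mulrA [X in _ + X - _]addrC addrA addrK.
rewrite def_m; apply: spanD.
  rewrite mulrDl mulr_suml; apply: spanD; first by apply: span_gen; have := w_gt0 j; lia.
  apply: span_sum => k; rewrite -mulrA; apply: spanZ.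
  have lt_k : ((weight w be).+1 + w k <= m)%N by apply/ltm/w_add.
  apply: filtration_le lt_k (leads_mul_var IHm _ lt_k).
  by rewrite -[mon be]mul1r -(rmorph1 iota); apply: span_gen.
apply: spanZ; apply: spanD.
  by apply: span_gen; rewrite weightD weight_unit; have := w_gt0 j; lia.
by apply: filtration_le (leads_mul_var IHm lead _); have := w_gt0 j; lia.
Qed.

Lemma filtration_mul_var i m a : F m a -> F (m + w i) (x i * a).
Proof. by move=> Fa; apply: leads_mul_var (@leadsP (m + w i)) Fa _. Qed.

(** Induction on [al]: prepending [x_j] to the leading term multiplies out to [c1 * c2], where [c1]
    comes from moving [x_j] past [c] and [c2] from straightening; this is nonzero as [R] is a
    domain. *)
Lemma lead_monom_mul al r be : exists c, (r != 0 -> c != 0) /\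
  F (weight w al + weight w be) (mon al * iota r * mon be - iota c * mon (al + be)).
Proof.
elim/exp_ind: al => [|j al al_j [c [c_neq0 lead]]].
  by exists r; rewrite monom0 mul1r add0r subrr; split=> //; apply: span0.
have [c1 [d [c1_neq0 xcE]]] := xr j c.
have [c2 [c2_neq0 lead2]] := leadsP (ltnSn (weight w (al + be) + w j)).
exists (c1 * c2); split; first by move=> /c_neq0 /c1_neq0 ?; apply: domain_mulf_neq0.
set f := (_ - _) in lead; set g := (_ - _) in lead2.
have -> : mon (al + unit_exp j) * iota r * mon be - iota (c1 * c2) * mon (al + unit_exp j + be)
    = iota c1 * g + iota d * mon (al + be) + x j * f.
  have -> : mon (al + unit_exp j) * iota r * mon be = x j * (iota c * mon (al + be) + f).
    by rewrite [X in x j * X]addrC subrK -monom_mul_var // !mulrA.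
  rewrite mulrDr mulrA xcE mulrDl -mulrA rmorphM -mulrA [iota c1 * g]mulrBr (addrAC al).
  by rewrite [LHS]addrAC; congr (_ + _); rewrite [LHS]addrAC.
have w_gt0 := w_adm.1 j; rewrite !weightD weight_unit in lead2 *.
apply: spanD; last by apply: filtration_le (filtration_mul_var j lead); lia.
apply: spanD; first by apply: spanZ; apply: filtration_le lead2; lia.
by apply: span_gen; rewrite weightD; lia.
Qed.

(** The bounds are strict: weights at most [m - 1] and [m' - 1] add up to at most [m + m' - 2],
    which explains [M.+1]. *)
Lemma filtration_mul m m' M a b : F m a -> F m' b -> (m + m' <= M.+1)%N -> F M (a * b).
Proof.
move=> Fa Fb le_M; elim: Fa => [|r al a' lt_al _ IHa]; first by rewrite mul0r; apply: span0.
rewrite mulrDl -mulrA; apply: spanD => {IHa}//; apply: spanZ.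
elim: Fb => [|s be b' lt_be _ IHb]; first by rewrite mulr0; apply: span0.
rewrite mulrDr mulrA; apply: spanD => //.
have [c [_ lead]] := lead_monom_mul al s be.
rewrite -(subrK (iota c * mon (al + be)) (_ * mon be)); apply: spanD.
  by apply: filtration_le lead; lia.
by apply: span_gen; rewrite weightD; lia.
Qed.

Lemma filtration_monom r al : F (weight w al).+1 (iota r * mon al).
Proof. exact: span_gen. Qed.

Lemma filtration_monom1 al : F (weight w al).+1 (mon al).
Proof. by rewrite -[mon al]mul1r -(rmorph1 iota); apply: filtration_monom. Qed.

(** Injectivity of the weight on [L] leaves only one term of maximal weight. *)
Lemma maximal_support (g : {ffun 'I_n -> nat} -> R) (L : seq {ffun 'I_n -> nat}) :
  {in L &, injective (weight w)} -> has (fun al => g al != 0) L ->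
  exists al, [/\ al \in L, g al != 0 &
    forall be, be \in L -> be != al -> g be != 0 -> (weight w be < weight w al)%N].
Proof.
move=> inj_w /hasP [al0 Lal0 g_al0].
pose P m := has (fun al => (g al != 0) && (weight w al == m)) L.
have exP : exists m, P m by exists (weight w al0); apply/hasP; exists al0; rewrite ?g_al0 /=.
have leP m : P m -> (m <= \max_(al <- L) weight w al)%N.
  by case/hasP=> al Lal /andP [_ /eqP <-]; apply: leq_bigmax_seq.
case: (ex_maxnP exP leP) => m /hasP [al Lal /andP [g_al /eqP <-]] max_al.
exists al; split=> // be Lbe be_al g_be; rewrite ltn_neqAle (inj_in_eq inj_w) // be_al /=.
by apply: max_al; apply/hasP; exists be; rewrite ?g_be /=.
Qed.

Section Freeness.
Hypothesis freeM : forall (s : seq {ffun 'I_n -> nat}) (c : {ffun 'I_n -> nat} -> R),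
  uniq s -> \sum_(al <- s) iota (c al) * mon al = 0 -> forall al, al \in s -> c al = 0.

(** Otherwise [iota c * mon al] would be a combination of monomials other than [x^al], against
    freeness. *)
Lemma lead_coef_unique al c : F (weight w al) (iota c * mon al) -> c = 0.
Proof.
move=> /span_finite [L [uniq_L /allP ltL /(span_coef uniq_L) [d dE]]].
have L'al : al \notin L by apply/negP => /ltL; rewrite ltnn.
have := @freeM (al :: L) (fun be => if be == al then - c else d be).
rewrite /= L'al uniq_L big_cons eqxx => /(_ isT) free0.
apply/eqP; rewrite -oppr_eq0; apply/eqP.
have := free0 _ al (mem_head _ _); rewrite eqxx; apply.
rewrite rmorphN mulNr dE addrC; apply/eqP; rewrite subr_eq0; apply/eqP.
by apply: eq_big_seq => be Lbe; case: eqP => // be_al; rewrite -be_al Lbe in L'al.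
Qed.

Lemma leading_term (L : seq {ffun 'I_n -> nat}) a :
  uniq L -> {in L &, injective (weight w)} -> span iota mon (mem L) a -> a != 0 ->
  exists al r, r != 0 /\ F (weight w al) (a - iota r * mon al).
Proof.
move=> uniq_L inj_w /(span_coef uniq_L) [c ->] a0.
have [|al [Lal c_al max_al]] := @maximal_support c L inj_w.
  apply: contraNT a0 => /hasPn c0; apply/eqP/big1_seq => be /= /c0.
  by rewrite negbK => /eqP ->; rewrite rmorph0 mul0r.
exists al, (c al); split=> //; rewrite (big_rem al) //= addrAC subrr add0r.
rewrite big_seq; apply: big_ind => [||be]; [exact: span0|exact: spanD|].
rewrite mem_rem_uniq // => /andP [be_al Lbe].
have [->|c_be] := eqVneq (c be) 0; first by rewrite rmorph0 mul0r; apply: span0.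
by apply: span_gen; apply: max_al.
Qed.

End Freeness.

End Weight.

(** * The domain property and the left Ore condition *)

Hypothesis freeM : forall (s : seq {ffun 'I_n -> nat}) (c : {ffun 'I_n -> nat} -> R),
  uniq s -> \sum_(al <- s) iota (c al) * mon al = 0 -> forall al, al \in s -> c al = 0.
Hypothesis spanM : forall a : A, exists s : seq ({ffun 'I_n -> nat} * R),
  a = \sum_(p <- s) iota p.2 * mon p.1.

Lemma span_monomials a : exists2 L, uniq L & span iota mon (mem L) a.
Proof.
have [s ->] := spanM a.
suff /span_finite [L [uniq_L _ La]] :
  span iota mon predT (\sum_(p <- s) iota p.2 * mon p.1) by exists L.
by apply: span_sum => p; apply: span_gen.
Qed.

Lemma skew_PBW_domain : is_domain A.
Proof.
move=> a b ab0; apply: contrapT => /not_orP [/eqP a0 /eqP b0].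
have [La uniq_La spa] := span_monomials a; have [Lb uniq_Lb spb] := span_monomials b.
(* One weight must separate the exponents of both factors. *)
have [w w_adm inj_w] := separating_weight (La ++ Lb).
have [|al [r [r0 lead_a]]] := leading_term (w := w) uniq_La _ spa a0.
  by move=> al be Lal Lbe; apply: inj_w; rewrite mem_cat ?Lal ?Lbe.
have [|be [s [s0 lead_b]]] := leading_term (w := w) uniq_Lb _ spb b0.
  by move=> ga be Lga Lbe; apply: inj_w; rewrite mem_cat ?Lga ?Lbe orbT.
have [c [/(_ s0) c0 lead]] := lead_monom_mul w_adm al s be.
suff /(lead_coef_unique freeM) /eqP : filtration w (weight w (al + be)) (iota (r * c) * mon (al + be)).
  by apply/negP/domain_mulf_neq0.
rewrite weightD; set f := a - _ in lead_a; set g := b - _ in lead_b; set h := (_ - _) in lead.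
(* Expanding [a b = 0] with [a = r x^al + f], [b = s x^be + g] and [x^al s x^be = c x^(al+be) + h]
   leaves only lower terms opposite the leading one. *)
have -> : iota (r * c) * mon (al + be) =
    - (iota r * h + iota r * mon al * g + f * b).
  rewrite /h /f /g !mulrBr mulrBl ab0 sub0r rmorphM !mulrA [X in - (X - _)]addrC.
  by rewrite addrA subrK [X in - X]addrAC subrr add0r opprK.
apply: spanN; apply: spanD; last first.
  apply: (@filtration_mul w w_adm _ (weight w be).+1 _ _ _ lead_a); last by rewrite addnS.
  rewrite -(subrK (iota s * mon be) b); apply: spanD; last exact: filtration_monom.
  exact: filtration_le lead_b.
apply: spanD; first exact: spanZ.
apply: (@filtration_mul w w_adm _ _ _ _ _ (filtration_monom w r al) lead_b).
by rewrite addSn.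
Qed.

(** Exponents of degree below [d] have entries below [d]; listing them through maps into ['I_d]
    yields the bound [d ^ n] on their number. *)
Definition bounded_exps d : seq {ffun 'I_n -> nat} :=
  [seq al <- [seq [ffun i => f i : nat] | f : {ffun 'I_n -> 'I_d}]
  | (weight (fun=> 1%N) al < d)%N].

Lemma bounded_exps_uniq d : uniq (bounded_exps d).
Proof.
apply: filter_uniq; rewrite map_inj_uniq ?enum_uniq // => f g /ffunP eq_fg.
by apply/ffunP => i; apply: val_inj; have := eq_fg i; rewrite !ffunE.
Qed.

Lemma mem_bounded_exps d al : (al \in bounded_exps d) = (weight (fun=> 1%N) al < d)%N.
Proof.
rewrite mem_filter; case: ltnP => //= lt_d.
have ltd i : (al i < d)%N.
  by apply: leq_ltn_trans lt_d; rewrite /weight (bigD1 i) //= muln1 leq_addr.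
apply/mapP; exists [ffun i => Ordinal (ltd i)]; first by rewrite mem_enum.
by apply/ffunP => i; rewrite !ffunE.
Qed.

Lemma size_bounded_exps d : (size (bounded_exps d) <= d ^ n)%N.
Proof.
rewrite size_filter; apply: leq_trans (count_size _ _) _.
by rewrite size_map -cardE card_ffun !card_ord.
Qed.

Let deg_adm : admissible (fun _ : 'I_n => 1%N).
Proof. by []. Qed.

Local Notation F := (filtration (fun=> 1%N)).

Lemma degree_filtration_exhaustive a : exists m, F m a.
Proof.
have [s ->] := spanM a; elim: s => [|p s [m Fm]]; first by exists 0%N; rewrite big_nil; apply: span0.
exists (maxn m (weight (fun=> 1%N) p.1).+1); rewrite big_cons; apply: spanD.
  by apply: span_gen; apply: leq_maxr.
by apply: filtration_le Fm; apply: leq_maxl.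
Qed.

Lemma skew_PBW_left_Ore : left_Ore_domain R -> left_Ore_domain A.
Proof.
move=> oreR; apply: (left_Ore_of_growth (e := mon) (L := bounded_exps) (n := n) oreR).
- exact: skew_PBW_domain.
- exact: bounded_exps_uniq.
- by move=> d d' le_d al; rewrite !mem_bounded_exps => /leq_trans ->.
- have : 0 \in bounded_exps 1 by rewrite mem_bounded_exps weight0.
  by case: bounded_exps.
- exact: size_bounded_exps.
- by move=> d c; apply: freeM; apply: bounded_exps_uniq.
move=> a; have [k Fa] := degree_filtration_exhaustive a; exists k => d al.
rewrite mem_bounded_exps => lt_al.
suff : F (d + k) (mon al * a).
  by apply: span_sub => be; rewrite -mem_bounded_exps.
by apply: (filtration_mul deg_adm (filtration_monom1 _ al) Fa); rewrite addSn ltnS leq_add2r ltnW.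
Qed.

(** * The right Ore condition *)

Section Right.
Hypothesis rx : forall i r, exists r' d, iota r * x i = x i * iota r' + iota d.

(** The coefficient passes the variables one at a time, and each passage leaves an error of smaller
    weight. *)
Lemma monom_right_coef w al r : admissible w -> exists r',
  filtration w (weight w al) (iota r * mon al - mon al * iota r').
Proof.
move=> w_adm; elim/exp_ind: al r => [|j al al_j IHal] r.
  by exists r; rewrite monom0 mulr1 mul1r subrr; apply: span0.
have [r1 [d rxE]] := rx j r; have [r2 lead] := IHal r1; exists r2.
set f := _ - _ in lead.
have -> : iota r * mon (al + unit_exp j) - mon (al + unit_exp j) * iota r2
    = iota d * mon al + x j * f.
  rewrite -monom_mul_var // mulrA rxE mulrDl mulrBr -!mulrA.
  by rewrite [X in X - _]addrC addrA.
rewrite weightD weight_unit; apply: spanD; last exact: filtration_mul_var.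
by apply: span_gen; have := w_adm.1 j; lia.
Qed.

(** Moving a coefficient to the right of its monomial costs an error of strictly smaller weight,
    which the induction on [m] absorbs. *)
Lemma span_right w m a : admissible w -> filtration w m a ->
  @span R^c A^c (conv_rmorphism iota) _ mon (fun al => weight w al < m)%N a.
Proof.
move=> w_adm; elim/ltn_ind: m a => m IHm a.
elim=> [|r al b lt_al _ IHb]; first exact: span0.
apply: (spanD (A := A^c)) => {IHb}//.
have [r' lead] := monom_right_coef al r w_adm.
rewrite -(subrK (mon al * iota r') (iota r * mon al)).
apply: (spanD (A := A^c)); last exact: (span_gen (conv_rmorphism iota) mon r' lt_al).
apply: span_sub (IHm _ lt_al _ lead) => be lt_be.
exact: ltn_trans lt_al.
Qed.

(** Rewritten with left coefficients, the term of maximal weight keeps a nonzero leading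
    coefficient, yet it equals minus the sum of lower terms. *)
Lemma right_free (L : seq {ffun 'I_n -> nat}) (c : {ffun 'I_n -> nat} -> R) :
  uniq L -> \sum_(al <- L) mon al * iota (c al) = 0 -> forall al, al \in L -> c al = 0.
Proof.
move=> uniq_L sum0 al0 Lal0; apply: contrapT => /eqP c_al0.
have [w w_adm inj_w] := separating_weight L.
have [|al [Lal c_al max_al]] := maximal_support (w := w) (g := c) inj_w.
  by apply/hasP; exists al0.
have lead be : exists d, (c be != 0 -> d != 0) /\
    filtration w (weight w be) (mon be * iota (c be) - iota d * mon be).
  have := lead_monom_mul w_adm be (c be) 0.
  by rewrite weight0 addn0 monom0 mulr1 addr0.
have [d [/(_ c_al) d0 lead_al]] := lead al.
suff /(lead_coef_unique freeM) /eqP : filtration w (weight w al) (iota d * mon al).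
  by rewrite (negbTE d0).
rewrite -[iota d * _](subKr (mon al * iota (c al))); apply: spanB => //.
move/eqP: sum0; rewrite (big_rem al) //= addr_eq0 => /eqP ->; apply: spanN.
rewrite big_seq; apply: big_ind => [||be]; [exact: span0|exact: spanD|].
rewrite mem_rem_uniq // => /andP [be_al Lbe].
have [->|c_be] := eqVneq (c be) 0; first by rewrite rmorph0 mulr0; apply: span0.
have [d' [_ lead_be]] := lead be; have lt_be := max_al be Lbe be_al c_be.
rewrite -(subrK (iota d' * mon be) (mon be * _)); apply: spanD; last exact: span_gen.
exact: filtration_le (ltnW lt_be) lead_be.
Qed.

Lemma skew_PBW_right_Ore : right_Ore_domain R -> right_Ore_domain A.
Proof.
move=> /conv_right_Ore_domain oreR; apply: right_Ore_domain_conv.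
apply: (@left_Ore_of_growth R^c A^c (conv_rmorphism iota) _ mon bounded_exps n oreR).
- exact/conv_is_domain/skew_PBW_domain.
- exact: bounded_exps_uniq.
- by move=> d d' le_d al; rewrite !mem_bounded_exps => /leq_trans ->.
- have : 0 \in bounded_exps 1 by rewrite mem_bounded_exps weight0.
  by case: bounded_exps.
- exact: size_bounded_exps.
- by move=> d c; apply: right_free; apply: bounded_exps_uniq.
(* The product of a monomial and [a] in [A^c] is [a * mon al] in [A], and [span_right] turns left
   spans into right ones. *)
suff filt (a : A) : exists m, forall d al, al \in bounded_exps d -> F (d + m) (a * mon al).
  move=> a; have [m aP] := filt a; exists m => d al /aP /(span_right deg_adm).
  by apply: span_sub => be; rewrite -mem_bounded_exps.
have [m Fa] := degree_filtration_exhaustive a; exists m => d al.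
rewrite mem_bounded_exps => lt_al.
apply: (filtration_mul deg_adm Fa (filtration_monom1 _ al)).
by rewrite addnC addSn ltnS leq_add2r ltnW.
Qed.

End Right.
End Filtration.

Theorem theorem3p6 (R A : nzRingType) (n : nat) (iota : {rmorphism R -> A})
    (x : 'I_n -> A) :
  bijective_skew_PBW iota x ->
  (left_Ore_domain R ->
     [/\ left_Ore_domain A,
         exists (Q : nzRingType) (phi : {rmorphism A -> Q}), left_total_fractions phi &
         forall (B : nzRingType) (psi : {rmorphism A -> B}), left_localization iota psi ->
         forall (Q : nzRingType) (phi : {rmorphism A -> Q})
                (Q' : nzRingType) (phi' : {rmorphism B -> Q'}),
           left_total_fractions phi -> left_total_fractions phi' -> ring_iso Q Q'])
  /\
  (right_Ore_domain R ->
     [/\ right_Ore_domain A,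
         exists (Q : nzRingType) (phi : {rmorphism A -> Q}), right_total_fractions phi &
         forall (B : nzRingType) (psi : {rmorphism A -> B}), right_localization iota psi ->
         forall (Q : nzRingType) (phi : {rmorphism A -> Q})
                (Q' : nzRingType) (phi' : {rmorphism B -> Q'}),
           right_total_fractions phi -> right_total_fractions phi' -> ring_iso Q Q']).
Proof.
move=> [[inj_iota spanM freeM xr xx] [sigma [xsigma bij_sigma]] _].
(* Including [r = 0] spares case distinctions during straightening. *)
have xr' i r : exists c d : R, (r != 0 -> c != 0) /\ x i * iota r = iota c * x i + iota d.
  have [->|r0] := eqVneq r 0; first by exists 0, 0; rewrite rmorph0 mulr0 mul0r addr0 eqxx.
  have [c [d [c0 /eqP]]] := xr i r r0; rewrite subr_eq addrC => /eqP xrE.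
  by exists c, d.
(* Surjectivity of [sigma i] writes [r] as [sigma i (tau r)]; the commutation rule for [tau r] is
   then solved for [r x_i]. *)
have rx i r : exists r' d : R, iota r * x i = x i * iota r' + iota d.
  have [tau _ sigmaK] := bij_sigma i; have [d] := xsigma i (tau r).
  by rewrite sigmaK => xE; exists (tau r), (- d); rewrite xE rmorphN addrK.
split=> oreR.
  have oreA : left_Ore_domain A by apply: skew_PBW_left_Ore oreR.1 xr' xx freeM spanM oreR.
  split=> //; first exact: exists_left_total_fractions.
  move=> B psi psiL Q phi Q' phi'.
  exact: (left_fractions_of_localization inj_iota oreR oreA psiL).
have oreA : right_Ore_domain A by apply: skew_PBW_right_Ore oreR.1 xr' xx freeM spanM rx oreR.
split=> //; first exact: exists_right_total_fractions.
move=> B psi psiL Q phi Q' phi'.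
exact: (right_fractions_of_localization inj_iota oreR oreA psiL).
Qed.
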